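(* Let $\widehat{H}\in\mathbb{R}^{n\times n}$ be a symmetric positive semidefinite approximation of $H = A^\top A$, and let $E = H - \widehat{H}$ denote the error in the approximation. Let $\delta x$ and $\delta\widehat{x}$ be the solutions of $$\Gamma^{-1/2}(I+H)\Gamma^{-1/2}\,\delta x = -g, \qquad \Gamma^{-1/2}(I+\widehat{H})\Gamma^{-1/2}\,\delta\widehat{x} = -g.$$ Then the relative error in the solution of the linear system satisfies $$\frac{\|\delta x - \delta\widehat{x}\|_{\Gamma^{-1}}}{\|\delta x\|_{\Gamma^{-1}}} \le \|E\|_2.$$
   Context: Setting: $A\in\mathbb{R}^{m\times n}$ with $m\le n$, $H = A^\top A\in\mathbb{R}^{n\times n}$, $\Gamma\in\mathbb{R}^{n\times n}$ is symmetric positive definite (the prior covariance), and $g\in\mathbb{R}^n$ is a nonzero vector (the gradient). The result is deterministic: $\widehat{H}$ need not come from a randomized or low-rank construction. Notation: $\|x\|_{M} = \|M^{1/2}x\|_2$ for symmetric positive definite $M$; $\|\cdot\|_2$ on matrices is the spectral norm. *)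

(* Defs.v *)
From HB Require Import structures.
From mathcomp Require Import all_boot all_order all_algebra.
From mathcomp Require Import all_classical all_reals.

Set Implicit Arguments.
Unset Strict Implicit.
Unset Printing Implicit Defensive.

Import Order.TTheory GRing.Theory Num.Theory.
Local Open Scope classical_set_scope.
Local Open Scope ring_scope.

Definition quadform (R : realType) (n : nat) (M : 'M[R]_n) (x : 'cV[R]_n) : R :=
  (x^T *m M *m x) 0 0.

Definition sym_psd (R : realType) (n : nat) (M : 'M[R]_n) : Prop :=
  M \is symmetricmx /\ forall x : 'cV[R]_n, 0 <= quadform M x.

Definition sym_posdef (R : realType) (n : nat) (M : 'M[R]_n) : Prop :=
  M \is symmetricmx /\ forall x : 'cV[R]_n, x != 0 -> 0 < quadform M x.

(* The principal square root M^{1/2}: the symmetric positive semidefinite S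
   with S *m S = M.  It exists and is unique when M is symmetric positive
   semidefinite; when there is no such S the value is 0. *)
Definition sqrtmx (R : realType) (n : nat) (M : 'M[R]_n) : 'M[R]_n :=
  xget 0 [set S : 'M[R]_n | sym_psd S /\ S *m S = M].

Definition l2norm (R : realType) (n : nat) (x : 'cV[R]_n) : R :=
  Num.sqrt (\sum_(i < n) x i 0 ^+ 2).

Definition wnorm (R : realType) (n : nat) (M : 'M[R]_n) (x : 'cV[R]_n) : R :=
  l2norm (sqrtmx M *m x).

(* The operator norm induced by the Euclidean norms.  The supremum is over the
   closed unit ball, not the sphere, so that the set is nonempty for n = 0. *)
Definition spectral_norm (R : realType) (m n : nat) (M : 'M[R]_(m, n)) : R :=
  sup [set l2norm (M *m x) | x in [set x : 'cV[R]_n | l2norm x <= 1]].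

(* Main.v *)
Require Import Defs.
From mathcomp Require Import all_boot all_order all_algebra.
From mathcomp Require Import all_classical all_reals.
From mathcomp Require Import lra.
Import Order.TTheory GRing.Theory Num.Theory.
Local Open Scope ring_scope.

(** With S = Gamma^(-1/2), u = S dx and w = S (dx - dxhat), cancelling S in the
    two systems gives (I + Hhat) w = - E u.  Pairing with w and using
    Hhat >= 0 yields |w|^2 <= - <w, E u>, and expanding 0 <= |w + E u|^2 turns
    this into |w| <= |E u| <= |E| |u|. *)

Lemma l2norm_ge0 (R : realType) (n : nat) (x : 'cV[R]_n) : 0 <= l2norm x.
Proof. exact: sqrtr_ge0. Qed.

Lemma l2normE (R : realType) (n : nat) (x : 'cV[R]_n) :
  l2norm x = Num.sqrt ((x^T *m x) 0 0).
Proof.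
by rewrite /l2norm mxE; congr Num.sqrt; apply: eq_bigr => i _; rewrite mxE expr2.
Qed.

Lemma dotmx_ge0 (R : realType) (n : nat) (x : 'cV[R]_n) : 0 <= (x^T *m x) 0 0.
Proof. by rewrite mxE sumr_ge0 // => i _; rewrite mxE -expr2 sqr_ge0. Qed.

Lemma dotmxC (R : realType) (n : nat) (x y : 'cV[R]_n) :
  (x^T *m y) 0 0 = (y^T *m x) 0 0.
Proof. by rewrite !mxE; apply: eq_bigr => i _; rewrite !mxE mulrC. Qed.

Lemma l2normZ (R : realType) (n : nat) (c : R) (x : 'cV[R]_n) :
  l2norm (c *: x) = `|c| * l2norm x.
Proof.
rewrite /l2norm -sqrtr_sqr -sqrtrM ?sqr_ge0 // mulr_sumr.
by congr Num.sqrt; apply: eq_bigr => i _; rewrite mxE exprMn.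
Qed.

Lemma l2norm_eq0 (R : realType) (n : nat) (x : 'cV[R]_n) :
  (l2norm x == 0) = (x == 0).
Proof.
apply/eqP/eqP => [|->]; last first.
  by rewrite l2normE mulmx0 mxE sqrtr0.
move=> x0; apply/matrixP => i j; rewrite (ord1 j) [RHS]mxE.
have /eqP : \sum_(i < n) x i 0 ^+ 2 = 0.
  apply/eqP; rewrite eq_le sumr_ge0 ?andbT; last by move=> k _; exact: sqr_ge0.
  by rewrite -sqrtr_eq0 -/(l2norm x) x0.
rewrite psumr_eq0; last by move=> k _; exact: sqr_ge0.
by move=> /allP/(_ i (mem_index_enum i)); rewrite sqrf_eq0 => /eqP.
Qed.

Lemma le_coord_l2norm (R : realType) (n : nat) (x : 'cV[R]_n) (i : 'I_n) :
  `|x i 0| <= l2norm x.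
Proof.
rewrite -sqrtr_sqr; apply: ler_wsqrtr.
by rewrite (bigD1 i) //= lerDl sumr_ge0 // => k _; exact: sqr_ge0.
Qed.

(** A real [sup] dominates the members of its set only once that set is known to be bounded
    above. *)
Lemma spectral_norm_has_ubound (R : realType) (m n : nat) (M : 'M[R]_(m, n)) :
  has_ubound [set l2norm (M *m x) | x in [set x : 'cV[R]_n | l2norm x <= 1]].
Proof.
(* The witness is the Euclidean norm of the vector of absolute row sums of [M]: on the unit ball
   every coordinate of [x] is at most 1 in absolute value, so each row sum bounds the matching entry
   of [M *m x]. *)
exists (Num.sqrt (\sum_(i < m) (\sum_(j < n) `|M i j|) ^+ 2)) => _ [x /= x1 <-].
apply/ler_wsqrtr/ler_sum => i _.
rewrite -[leLHS]real_normK ?num_real // ler_sqr ?nnegrE ?sumr_ge0 //.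
rewrite mxE; apply: le_trans (ler_norm_sum _ _ _) _; apply: ler_sum => j _.
by rewrite normrM ler_piMr //; exact: le_trans (le_coord_l2norm _ _ _ _) x1.
Qed.

(** By homogeneity: [x / |x|] lies in the unit ball, hence under the supremum. The vector 0 cannot
    be normalized and is treated apart. *)
Lemma l2norm_mulmx_le (R : realType) (m n : nat) (M : 'M[R]_(m, n))
    (x : 'cV[R]_n) :
  l2norm (M *m x) <= spectral_norm M * l2norm x.
Proof.
have [->|x0] := eqVneq x 0.
  have z k : l2norm (0 : 'cV[R]_k) = 0 by apply/eqP; rewrite l2norm_eq0.
  by rewrite mulmx0 !z mulr0.
have nx_gt0 : 0 < l2norm x by rewrite lt_def l2norm_eq0 x0 l2norm_ge0.
rewrite -ler_pdivrMr // mulrC.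
have -> : (l2norm x)^-1 * l2norm (M *m x) = l2norm (M *m ((l2norm x)^-1 *: x)).
  by rewrite -scalemxAr l2normZ ger0_norm // invr_ge0 l2norm_ge0.
apply: (ub_le_sup (spectral_norm_has_ubound _ _ _ M)).
exists ((l2norm x)^-1 *: x) => //=.
by rewrite l2normZ ger0_norm ?invr_ge0 ?l2norm_ge0 // mulVf // gt_eqF.
Qed.

(** A nonzero [v] with [v *m M = 0] would make the quadratic form vanish at [v^T]. *)
Lemma sym_posdef_unitmx (R : realType) (n : nat) (M : 'M[R]_n) :
  sym_posdef M -> M \in unitmx.
Proof.
move=> [_ Mpos]; rewrite unitmxE unitfE; apply/negP => /det0P [v v0 vM].
have := Mpos v^T; rewrite /quadform trmxK vM mul0mx mxE ltxx.
by rewrite -(inj_eq trmx_inj) trmxK trmx0 v0 => /(_ isT).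
Qed.

Lemma l2norm_le_psd_shift (R : realType) (n : nat) (K : 'M[R]_n)
    (w : 'cV[R]_n) :
  sym_psd K -> l2norm w <= l2norm ((1%:M + K) *m w).
Proof.
move=> [_ /(_ w)]; rewrite /quadform => Kw; rewrite !l2normE; apply: ler_wsqrtr.
set f := (1%:M + K) *m w.
have wf : (w^T *m f) 0 0 = (w^T *m w) 0 0 + (w^T *m K *m w) 0 0.
  by rewrite /f mulmxDl mul1mx mulmxDr mxE mulmxA.
(* Expanding [0 <= |w - f|^2] gives [2 <w, f> <= |w|^2 + |f|^2], while [wf] and [Kw] give
   [|w|^2 <= <w, f>]; together [|w|^2 <= |f|^2]. *)
have := dotmx_ge0 _ _ (w - f).
have mxB (M N : 'M[R]_1) : (M - N) 0 0 = M 0 0 - N 0 0 by rewrite !mxE.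
have -> : (w - f)^T = w^T - f^T by rewrite linearB.
rewrite mulmxBl !mulmxBr !mxB.
have := dotmxC _ _ w f.
lra.
Qed.

Theorem theorem4 (R : realType) (m n : nat) (le_mn : (m <= n)%N)
    (A : 'M[R]_(m, n)) (Gamma Hhat : 'M[R]_n) (g dx dxhat : 'cV[R]_n) :
  let H := A^T *m A in
  let E := H - Hhat in
  let Gamma_mhalf := sqrtmx (invmx Gamma) in
  sym_posdef Gamma ->
  sym_psd Hhat ->
  g != 0 ->
  Gamma_mhalf *m (1%:M + H) *m Gamma_mhalf *m dx = - g ->
  Gamma_mhalf *m (1%:M + Hhat) *m Gamma_mhalf *m dxhat = - g ->
  wnorm (invmx Gamma) (dx - dxhat) / wnorm (invmx Gamma) dx <= spectral_norm E.
Proof.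
move=> H E S Gpos Hpsd g0 eqx eqxhat.
(* The junk value 0 of [sqrtmx] would force g = 0, so the existence of the
   square root need not be proved. *)
have S0 : S != 0.
  by apply: contraNneq g0 => S0; rewrite -oppr_eq0 -eqx S0 !mul0mx.
have SS : S *m S = invmx Gamma.
  move: S0; rewrite /S /sqrtmx; case: xgetP => [T -> [_ ->] //|_].
  by rewrite eqxx.
have Sunit : S \in unitmx.
  have : S *m S \in unitmx by rewrite SS unitmx_inv sym_posdef_unitmx.
  by rewrite unitmx_mul => /andP[].
rewrite /wnorm -/S mulmxBr.
set u := S *m dx; set v := S *m dxhat.
(* This makes the denominator positive, so that the quotient is a true relative error and can be
   cleared. *)
have u0 : u != 0.
  by apply: contraNneq g0 => u0; rewrite -oppr_eq0 -eqx -mulmxA -/u u0 mulmx0.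
have eq_uv : (1%:M + H) *m u = (1%:M + Hhat) *m v.
  by apply: (can_inj (mulKmx Sunit)); rewrite !mulmxA eqx eqxhat.
(* By [eq_uv] the left side is [(1 + Hhat) u - (1 + H) u]. The sign is written as a scaling so that
   [l2normZ] removes it. *)
have err : (1%:M + Hhat) *m (u - v) = (-1) *: (E *m u).
  rewrite mulmxBr -eq_uv -mulmxBl opprD addrACA subrr add0r.
  by rewrite scaleN1r -[RHS]mulNmx opprB.
have nu_gt0 : 0 < l2norm u by rewrite lt_def l2norm_eq0 u0 l2norm_ge0.
rewrite ler_pdivrMr //; apply: le_trans (l2norm_mulmx_le _ _ _ E u).
apply: le_trans (l2norm_le_psd_shift _ _ _ _ Hpsd) _.
by rewrite err l2normZ normrN1 mul1r.
Qed.
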